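(* Let $\delta\in(0,1)$ and let $\mathcal{C}$ be a class of subsets of $\{1,\ldots,n\}$, each of cardinality $K\ge1$. Let $S,S'$ be drawn independently and uniformly at random from $\mathcal{C}$ and assume that: (i) the conditional distribution of $|S\cap S'|$ given $S'$ is identical for all values of $S'$; (ii) for any fixed $S_0\in\mathcal{C}$ and $i\in S_0$, $\mathbb{P}\{i\in S\}=K/n$. Suppose that the labels are such that $\{1,2,\ldots,K\}\in\mathcal{C}$. If the random variables $\mathbf{1}_{\{1\in S\}},\ldots,\mathbf{1}_{\{K\in S\}}$ (with $S$ uniformly distributed on $\mathcal{C}$) are negatively associated, then $R^*_{\mathcal{C}}(\mu)\ge\delta$ for all $\mu>0$ with $$\mu\ \le\ \sqrt{\log\left(1+\frac{n\log\left(1+4(1-\delta)^2\right)}{K^2}\right)}.$$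
   Context: Negative association: random variables $Y_1,\ldots,Y_m$ are negatively associated if for any pair of disjoint sets $I,J\subset\{1,\ldots,m\}$ and any coordinate-wise nondecreasing functions $f,g$, $\mathbb{E}[f(Y_i,i\in I)\,g(Y_j,j\in J)]\le\mathbb{E}[f(Y_i,i\in I)]\,\mathbb{E}[g(Y_j,j\in J)]$. Setting: $\mathcal{C}=\{S_1,\ldots,S_N\}$ is a class of $N\ge 1$ distinct subsets of $\{1,\ldots,n\}$, all of the same cardinality $K$. Under $\mathbb{P}_0$, the components of the random vector $\mathbf{X}=(X_1,\ldots,X_n)$ are independent standard normal. For $S\in\mathcal{C}$, under $\mathbb{P}_S$ the components are independent with $X_i\sim\mathcal{N}(\mu,1)$ for $i\in S$ and $X_i\sim\mathcal{N}(0,1)$ for $i\notin S$, where $\mu>0$. The risk of a (measurable) test $f:\mathbb{R}^n\to\{0,1\}$ is $$R(f)=\mathbb{P}_0\{f(\mathbf{X})=1\}+\frac1N\sum_{S\in\mathcal{C}}\mathbb{P}_S\{f(\mathbf{X})=0\},$$ and $R^*=R^*_{\mathcal{C}}(\mu)$ denotes the minimum of $R(f)$ over all tests $f$. Equivalently, $R^*_{\mathcal{C}}(\mu)=1-\frac12\mathbb{E}_0|L(\mathbf{X})-1|$, where $L(\mathbf{x})=\frac1N\sum_{S\in\mathcal{C}}e^{\mu x_S-K\mu^2/2}$ with $x_S=\sum_{i\in S}x_i$. *)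

(* Defs.v *)
From HB Require Import structures.
From mathcomp Require Import all_boot all_order all_algebra.
From mathcomp Require Import all_classical all_reals all_analysis.
Set Implicit Arguments.
Unset Strict Implicit.
Unset Printing Implicit Defensive.
Import Order.TTheory GRing.Theory Num.Theory.
Local Open Scope ring_scope.

(* Finite probability under the uniform distribution on the finite set [D]. *)
Section uniform_finite.
Variables (R : realType) (T : finType) (D : {set T}).

Definition unif_prob (A : pred T) : R :=
  #|[pred x in D | A x]|%:R / #|D|%:R.

Definition unif_cond_prob (A B : pred T) : R :=
  unif_prob (predI A B) / unif_prob B.

Definition unif_expect (X : T -> R) : R := (\sum_(x in D) X x) / #|D|%:R.

Definition coord_nondecreasing (I : Type) (f : (I -> R) -> R) : Prop :=
  forall x y : I -> R, (forall i, x i <= y i) -> f x <= f y.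

Definition negatively_associated (M : finType) (Y : M -> T -> R) : Prop :=
  forall (I J : {set M})
    (f : ({i | i \in I} -> R) -> R) (g : ({j | j \in J} -> R) -> R),
  [disjoint I & J] -> coord_nondecreasing f -> coord_nondecreasing g ->
  let fY x := f (fun i => Y (val i) x) in
  let gY x := g (fun j => Y (val j) x) in
  unif_expect (fun x => fY x * gY x) <= unif_expect fY * unif_expect gY.

End uniform_finite.

Local Open Scope classical_set_scope.

Definition tcons d (T : measurableType d) n (p : T * n.-tuple T) :
  n.+1.-tuple T := [the n.+1.-tuple T of p.1 :: p.2].

Lemma measurable_tcons d (T : measurableType d) n :
  measurable_fun [set: T * n.-tuple T] (@tcons d T n).
Proof. exact: measurable_cons. Qed.

HB.instance Definition _ d (T : measurableType d) n :=
  @isMeasurableFun.Build _ _ _ _ (@tcons d T n) (@measurable_tcons d T n).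

(* The law of a vector of independent coordinates, the [i]-th one of law [P i];
   see [prod_prob_box]. *)
Fixpoint prod_prob d (T : measurableType d) (R : realType) n :
    ('I_n -> probability T R) -> probability (n.-tuple T) R :=
  match n with
  | 0 => fun=> \d_([tuple] : 0.-tuple T)
  | m.+1 => fun P =>
      distribution (P ord0 \x prod_prob (fun i => P (lift ord0 i)))%E
        (@tcons d T m)
  end.

Lemma prod_prob_box d (T : measurableType d) (R : realType) n
    (P : 'I_n -> probability T R) (A : 'I_n -> set T) :
  (forall i, measurable (A i)) ->
  prod_prob P [set x | forall i, A i (tnth x i)] = (\prod_(i < n) P i (A i))%E.
Proof.
elim: n P A => [|n IHn] P A mA.
  rewrite big_ord0 /= diracE mem_set//= => -[]; by case.
have mB m (B : 'I_m -> set T) : (forall i, measurable (B i)) ->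
    measurable [set x : m.-tuple T | forall i, B i (tnth x i)].
  move=> mB; rewrite (_ : mkset _ =
      \bigcap_(i in [set: 'I_m]) ((fun x : m.-tuple T => tnth x i) @^-1` B i)).
    apply: fin_bigcap_measurable => // i _; rewrite -[_ @^-1` _]setTI.
    exact: measurable_tnth.
  by apply/seteqP; split=> x /= Bx i => [_|]; exact: Bx.
rewrite big_ord_recl -(IHn _ (fun i => A (lift ord0 i))); last first.
  by move=> i; exact: mA.
rewrite /= /distribution /pushforward.
have mB' := mB _ (fun i => A (lift ord0 i)) (fun i => mA _).
rewrite -(product_measure1E _ _ (mA ord0) mB').
congr (_ _); apply/seteqP; split=> -[x y] /= H.
  split; first by have := H ord0; rewrite tnth0.
  by move=> i; have := H (lift ord0 i); rewrite tnthS.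
move=> i; have [->|] := eqVneq i ord0; first by rewrite tnth0; case: H.
case: (unliftP ord0 i) => [j ->|->]; last by rewrite eqxx.
by rewrite tnthS; case: H => _ /(_ j).
Qed.

(* The second parameter of [normal_prob] is the standard deviation. *)
Definition gauss_prob (R : realType) n (m : 'I_n -> R) :
    probability (n.-tuple (measurableTypeR R)) R :=
  prod_prob (fun i => normal_prob (m i) 1).

Definition P_null (R : realType) n := gauss_prob (fun _ : 'I_n => 0 : R).

Definition P_alt (R : realType) n (mu : R) (S : {set 'I_n}) :=
  gauss_prob (fun i => if i \in S then mu else 0).

Definition test (R : realType) n := {mfun n.-tuple (measurableTypeR R) >-> bool}.

Definition risk (R : realType) n (C : {set {set 'I_n}}) (mu : R)
    (f : test R n) : R :=
  fine (P_null R n [set x | f x = true]) +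
  (#|C|%:R)^-1 * \sum_(S in C) fine (P_alt mu S [set x | f x = false]).

(* The infimum is a minimum; see [min_risk_attained]. *)
Definition min_risk (R : realType) n (C : {set {set 'I_n}}) (mu : R) : R :=
  inf (range (@risk R n C mu)).

Lemma min_risk_attained (R : realType) n (C : {set {set 'I_n}}) (mu : R) :
  exists f : test R n, risk C mu f = min_risk C mu.
Proof.
set c : R := (#|C|%:R)^-1.
have [q qE] : exists q : {charge set (n.-tuple (measurableTypeR R)) -> \bar R},
    forall A, q A = (\sum_(S <- enum C) P_alt mu S A)%E.
  elim: (enum C) => [|S s [q qE]].
    by exists czero => A; rewrite big_nil.
  exists (cadd (charge_of_finite_measure (P_alt mu S)) q) => A.
  by rewrite big_cons -qE.
pose nu := cadd (cscale c q) (copp (charge_of_finite_measure (P_null R n))).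
have [A [B [[mA posA] [mB negB] AB1 AB0]]] := Hahn_decomposition nu.
have nuD X Y : measurable X -> measurable Y ->
  nu X = (nu (X `\` Y) + nu (X `&` Y))%E by exact: chargeDI.
have mf (f : test R n) b : measurable [set x | f x = b].
  rewrite (_ : mkset _ = f @^-1` [set b])//.
  by rewrite -[_ @^-1` _]setTI; exact: measurable_funP.
have riskE (f : test R n) : risk C mu f = 1 + fine (nu [set x | f x = false]).
  have pE (p : probability (n.-tuple (measurableTypeR R)) R) :
      p [set x | f x = false] = (fine (p [set x | f x = false]))%:E.
    by rewrite fineK// fin_num_measure//; exact: mf.
  have -> : nu [set x | f x = false] =
      (c%:E * q [set x | f x = false] - P_null R n [set x | f x = false])%E by [].
  rewrite qE /risk.
  rewrite (_ : [set x | f x = true] = ~` [set x | f x = false]); last first.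
    by apply/seteqP; split=> x /=; case: (f x).
  rewrite probability_setC; last exact: mf.
  rewrite (pE (P_null R n)) (eq_bigr _ (fun S _ => pE (P_alt mu S))).
  rewrite sumEFin -EFinM -!EFinB/= big_enum/=.
  by rewrite addrAC -addrA.
pose f0 x : bool := x \in A.
have mf0 : measurable_fun [set: n.-tuple (measurableTypeR R)] f0.
  apply: (measurable_fun_bool true); rewrite setTI.
  rewrite (_ : _ @^-1` _ = A)//; apply/seteqP; split=> x /=.
    by rewrite /f0 => /set_mem.
  by move=> ?; exact: mem_set.
pose f0' : test R n := HB.pack f0 (isMeasurableFun.Build _ _ _ _ f0 mf0).
have Hmin f : risk C mu f0' <= risk C mu f.
  have mF : measurable [set x | f x = false] by exact: mf.
  suff key : (nu B <= nu [set x | f x = false])%E.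
    rewrite !riskE lerD2l (_ : [set x | f0' x = false] = B); last first.
      apply/seteqP; split=> x /= => [/negbT|Bx].
        rewrite notin_setE => nAx.
        have : [set: n.-tuple (measurableTypeR R)] x by [].
        by rewrite -AB1 => -[].
      apply: negbTE; rewrite notin_setE => Ax.
      by rewrite -[False]/(set0 x) -AB0.
    by apply: fine_le => //; apply: fin_num_measure.
  set F := mkset _.
  apply: (@le_trans _ _ (nu (B `&` F))).
    rewrite (nuD _ _ mB mF).
    rewrite -[leRHS]add0e leeD2r//.
    by apply: negB; [exact: measurableD|exact: subDsetl].
  rewrite (nuD _ _ mF mB) setIC.
  rewrite -[leLHS]add0e leeD2r//.
  apply: posA; first exact: measurableD.
  by move=> x [_ nBx]; have : [set: _] x by []; rewrite -AB1 => -[].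
exists f0'; apply/eqP; rewrite eq_le; apply/andP; split.
  by apply: lb_le_inf => [|_ [f _ <-]]; [exists (risk C mu f0'), f0'|].
by apply: ge_inf; [exists (risk C mu f0') => _ [f _ <-]|exists f0'].
Qed.

(* Main.v *)
Require Import Defs.
From mathcomp Require Import all_boot all_order all_algebra.
From mathcomp Require Import all_classical all_reals all_analysis.
From mathcomp Require Import measurable_realfun ring lra.
Import Order.TTheory GRing.Theory Num.Theory.
Local Open Scope ring_scope.

(** With [A] the event that a test accepts the alternative and [L] the mixture
likelihood ratio, the risk is [1 - (b - a)], where [a = P_0 A] and
[b = E_0 (L 1_A)].  Expanding [E_0 (L - 1 - t (1_A - a))^2 >= 0] at
[t = 4 (b - a)] gives [4 (b - a)^2 <= E_0 L^2 - 1], and for Gaussian shifts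
[E_0 L^2 = E exp (mu^2 |S :&: S'|)].  By (i), [S'] may be replaced by
[{1, .., K}]; negative association then bounds the moment by a product of [K]
Bernoulli moments, i.e. by [(1 + (e^(mu^2) - 1) K / n)^K], and [1 + x <= e^x]
finishes. *)

(** * Uniform averages, negative association and overlaps *)

Lemma unif_expect_ge0 {R : realType} {T : finType} (D : {set T}) (X : T -> R) :
  (forall x, 0 <= X x) -> 0 <= unif_expect D X.
Proof. by move=> X0; rewrite mulr_ge0 ?invr_ge0// sumr_ge0. Qed.

Lemma eq_unif_expect {R : realType} {T : finType} (D : {set T}) (X Y : T -> R) :
  X =1 Y -> unif_expect D X = unif_expect D Y.
Proof. by move=> XY; congr (_ / _); apply: eq_bigr => x _. Qed.

(** Induction on [#|I|]: one index [i] is split off, and negative association is applied to the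
    disjoint sets [[set i]] and [I :\ i]. Products of [phi] are coordinatewise nondecreasing because
    [phi] is both nonnegative and monotone. *)
Lemma negatively_associated_prod {R : realType} {T M : finType} (D : {set T})
    (Y : M -> T -> R) (phi : R -> R) (I : {set M}) :
  D != finset.set0 -> negatively_associated D Y ->
  (forall y, 0 <= phi y) -> {homo phi : x y / x <= y} ->
  unif_expect D (fun x => \prod_(i in I) phi (Y i x)) <=
  \prod_(i in I) unif_expect D (fun x => phi (Y i x)).
Proof.
move=> D0 na phi0 phi_homo; have [m] := ubnP #|I|.
elim: m I => // m IHm J Jm; have [->|[i iJ]] := set_0Vmem J.
  rewrite big_set0 (@eq_unif_expect _ _ _ _ (fun=> 1)); last first.
    by move=> x; rewrite big_set0.
  by rewrite /unif_expect sumr_const divff// pnatr_eq0 cards_eq0.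
rewrite -(finset.setD1K iJ); set I := (J :\ i)%SET.
have iI : i \notin I by rewrite finset.setD11.
have IH : unif_expect D (fun x => \prod_(j in I) phi (Y j x)) <=
    \prod_(j in I) unif_expect D (fun x => phi (Y j x)).
  by apply: IHm; move: Jm; rewrite (cardsD1 i) iJ.
rewrite [leRHS]big_setU1//=.
have prod_homo (L : {set M}) : coord_nondecreasing
    (fun y : {j | j \in L} -> R => \prod_j phi (y j)).
  by move=> y z yz; apply: ler_prod => j _; rewrite phi0 phi_homo.
have disj : [disjoint [set i]%SET & I] by rewrite finset.disjoints1.
have := na _ _ _ _ disj (prod_homo _) (prod_homo _).
have prodE (L : {set M}) x : \prod_(j : {j | j \in L}) phi (Y (val j) x) =
    \prod_(j in L) phi (Y j x) by rewrite [RHS]big_sub.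
(* The induction hypothesis may be multiplied by the factor of [i], since that average is
   nonnegative. *)
rewrite /= => naI; rewrite (le_trans _ (ler_wpM2l _ IH))//; last first.
  exact: unif_expect_ge0.
move: naI; rewrite (@eq_unif_expect _ _ _ _
  (fun x => \prod_(j in i |: I) phi (Y j x))); last first.
  by move=> x; rewrite !prodE big_set1 big_setU1.
rewrite [X in _ <= X * _ -> _](@eq_unif_expect _ _ _ _ (fun x => phi (Y i x)));
  last by move=> x; rewrite prodE big_set1.
by rewrite [X in _ <= _ * X -> _](@eq_unif_expect _ _ _ _
  (fun x => \prod_(j in I) phi (Y j x))) // => x; rewrite prodE.
Qed.

(** Grouping by overlap size shows that the sum depends on [S0] only through the counts that
    hypothesis (i) controls. *)
Lemma sum_card_setI {R : realType} {T : finType} (C : {set {set T}})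
    (S0 : {set T}) (F : nat -> R) :
  \sum_(S in C) F #|S :&: S0| =
  \sum_(k < #|T|.+1) #|[set S in C | #|S :&: S0| == k]%SET|%:R * F k.
Proof.
(* No overlap exceeds [#|T|], so [inord] never falls back to its default value here. *)
rewrite (partition_big (fun S : {set T} => inord #|S :&: S0| : 'I_#|T|.+1)
  predT)//=.
apply: eq_bigr => k _; rewrite mulr_natl -sumr_const.
have E (S : {set T}) : (inord #|S :&: S0| == k) = (#|S :&: S0| == k :> nat).
  by rewrite -val_eqE/= inordK// ltnS max_card.
apply: eq_big => S; first by rewrite inE E.
by rewrite E => /andP[_ /eqP ->].
Qed.

(** Fixing the second component leaves a copy of [D] inside [D * D]; the normalisation by [#|D| ^ 2]
    cancels in the quotient. *)
Lemma unif_cond_prob_snd {R : realType} {T : finType} (D : {set T})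
    (A : T -> T -> bool) (x0 : T) : x0 \in D ->
  unif_cond_prob R (finset.setX D D) (fun p => A p.1 p.2)
    (fun p => p.2 == x0) = #|[set x in D | A x x0]%SET|%:R / #|D|%:R.
Proof.
move=> x0D.
have D0 : (#|D|%:R : R) != 0.
  by rewrite pnatr_eq0 cards_eq0; apply/set0Pn; exists x0.
(* Kept general in [B]: the choice [A] counts the numerator, the constant [true] the denominator. *)
have cardE (B : T -> T -> bool) :
    #|[pred p in finset.setX D D | B p.1 p.2 && (p.2 == x0)]| =
    #|[set x in D | B x x0]%SET|.
  rewrite -(card_imset _ (_ : injective (fun x => (x, x0)))); last first.
    by move=> x y [].
  apply: eq_card => -[x y]; rewrite !inE/=; apply/idP/imsetP => [|[z]].
    case/and3P => /andP[xD _] Bxy /eqP yx0; move: Bxy; rewrite yx0 => Bx.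
    by exists x; rewrite ?inE ?xD.
  by rewrite inE => /andP[zD Bz] [-> ->]; rewrite zD x0D Bz eqxx.
rewrite /unif_cond_prob /unif_prob.
have -> : #|[pred p in finset.setX D D | (p.2 == x0)]| = #|D|.
  transitivity #|[set x in D | true]%SET|.
    exact: (cardE (fun _ _ => true)).
  by apply: eq_card => x; rewrite inE andbT.
rewrite [X in X%:R / _ / _](cardE A) finset.cardsX natrM.
by field.
Qed.

Lemma unif_expect_expR_indicator {R : realType} {T : finType} (D : {set T})
    (A : pred T) (t : R) : D != finset.set0 ->
  unif_expect D (fun x => expR (t * (A x)%:R)) =
  1 + (expR t - 1) * unif_prob R D A.
Proof.
move=> D0; have N0 : (#|D|%:R : R) != 0 by rewrite pnatr_eq0 cards_eq0.
rewrite /unif_expect /unif_prob.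
(* On the values 0 and 1 the exponential agrees with its affine interpolation. *)
rewrite (eq_bigr (fun x => 1 + (expR t - 1) * (A x)%:R)); last first.
  move=> x _; case: (A x); first by rewrite !mulr1 subrKC.
  by rewrite !mulr0 expR0 addr0.
rewrite big_split/= sumr_const -mulr_sumr mulrDl divff// -mulrA.
congr (_ + _ * (_ / _)); rewrite -natr_sum -big_mkcondr/= sum1_card.
by congr (_%:R); apply: eq_card => x; rewrite !inE.
Qed.

Lemma unif_expect_overlap {R : realType} {T : finType} (C : {set {set T}})
    (S1 S2 : {set T}) (F : nat -> R) : S1 \in C -> S2 \in C ->
  (forall k : nat,
    unif_cond_prob R (finset.setX C C)
      (fun p => #|p.1 :&: p.2| == k) (fun p => p.2 == S1) =
    unif_cond_prob R (finset.setX C C)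
      (fun p => #|p.1 :&: p.2| == k) (fun p => p.2 == S2)) ->
  unif_expect C (fun S => F #|S :&: S1|) =
  unif_expect C (fun S => F #|S :&: S2|).
Proof.
move=> S1C S2C overlap; rewrite /unif_expect !sum_card_setI; congr (_ / _).
apply: eq_bigr => k _; congr (_ * _); have := overlap k.
rewrite !(unif_cond_prob_snd C (fun A B : {set T} => #|A :&: B| == k))//.
move/mulIf => -> //; rewrite invr_eq0 pnatr_eq0 cards_eq0.
by apply/set0Pn; exists S1.
Qed.

Lemma unif_expect_le {R : realType} {T : finType} (D : {set T}) (X : T -> R)
    (B : R) : D != finset.set0 -> (forall x, x \in D -> X x <= B) ->
  unif_expect D X <= B.
Proof.
move=> D0 XB; have N0 : 0 < #|D|%:R :> R by rewrite ltr0n card_gt0.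
by rewrite ler_pdivrMr// mulr_natr -sumr_const ler_sum.
Qed.

(** The overlap is a sum of indicators, so its exponential is a product of nondecreasing functions
    of them (here [0 <= t] matters). Negative association reduces it to equal Bernoulli factors
    [1 + (expR t - 1) * p]. *)
Lemma negatively_associated_mgf_le {R : realType} {T : finType} (A : pred T)
    (C : {set {set T}}) (p t : R) : C != finset.set0 -> 0 <= t -> 0 <= p ->
  (forall i, A i -> unif_prob R C (fun S => i \in S) = p) ->
  negatively_associated C
    (fun (i : {i : T | A i}) (S : {set T}) => (val i \in S)%:R : R) ->
  unif_expect C (fun S => expR (t * #|S :&: [set i | A i]%SET|%:R)) <=
  expR ((expR t - 1) * p * #|A|%:R).
Proof.
move=> C0 t0 p0 marginal neg_assoc.
have prodE (S : {set T}) : expR (t * #|S :&: [set i | A i]%SET|%:R) =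
    \prod_(i in [set: {i : T | A i}]%SET) expR (t * (val i \in S)%:R).
  rewrite -expR_sum -mulr_sumr -natr_sum; congr (expR (_ * _%:R)).
  rewrite (eq_bigl predT); last by move=> i; rewrite inE.
  rewrite -(big_sub A (fun i : T => (i \in S) : nat)).
  rewrite -big_mkcondr sum1_card; apply: eq_card => i.
  by rewrite !inE andbC.
rewrite (eq_unif_expect _ _ _ prodE).
apply: (le_trans (negatively_associated_prod C _ (fun y => expR (t * y)) _
  C0 neg_assoc _ _)) => [y|x y xy|]; first exact: expR_ge0.
  by rewrite ler_expR ler_wpM2l.
rewrite (eq_bigr (fun=> 1 + (expR t - 1) * p)); last first.
  by move=> i _; rewrite unif_expect_expR_indicator// marginal// (valP i).
rewrite prodr_const cardsT card_sig expRM_natr.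
rewrite (_ : #|_| = #|A|); last by apply: eq_card => i; rewrite !inE.
have x0 : 0 <= (expR t - 1) * p by rewrite mulr_ge0// subr_ge0 -expR0 ler_expR.
by apply: lerXn2r; rewrite ?nnegrE ?addr_ge0 ?expR_ge0// expR_ge1Dx.
Qed.

Lemma unif_expectM {R : realType} {T : finType} (D : {set T}) (X Y : T -> R) :
  unif_expect D X * unif_expect D Y =
  unif_expect D (fun x => unif_expect D (fun y => X x * Y y)).
Proof.
rewrite /unif_expect mulrAC mulr_suml; congr (_ / _).
by apply: eq_bigr => x _; rewrite -mulr_sumr mulrA.
Qed.

(** * Change of measure through a density *)

Import HBNNSimple.

Lemma integral_prob1 {d} {T : measurableType d} {R : realType}
  (P : probability T R) : (\int[P]_x 1 = 1)%E.
Proof. by rewrite integral_cst// mul1e; exact: probability_setT. Qed.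

Lemma integral_indicT {d} {T : measurableType d} {R : realType}
    (P : probability T R) (A : set T) : measurable A ->
  (\int[P]_x (\1_A x)%:E = P A)%E.
Proof. by move=> mA; rewrite integral_indic// setIT. Qed.

(** Simple functions increase to [f]; monotone convergence on both sides reduces the identity to
    level sets, where it is the hypothesis on [nu]. *)
Lemma integral_density {d} {T : measurableType d} {R : realType}
    (mu nu : {measure set T -> \bar R}) (w : T -> R) (f : T -> \bar R) :
  measurable_fun setT w -> (forall x, 0 <= w x) ->
  (forall A, measurable A -> nu A = (\int[mu]_(x in A) (w x)%:E)%E) ->
  measurable_fun setT f -> (forall x, (0 <= f x)%E) ->
  (\int[nu]_x f x = \int[mu]_x (f x * (w x)%:E))%E.
Proof.
move=> mw w0 nuE mf f0.
have mwE : measurable_fun setT (EFin \o w) by exact/measurable_EFinP.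
pose h := nnsfun_approx measurableT mf.
have hf x : ((h n x)%:E @[n --> \oo] --> f x)%classic.
  by apply: cvg_nnsfun_approx.
transitivity (limn (fun n => \int[nu]_x (h n x)%:E)%E).
  rewrite -monotone_convergence//.
  - by apply: eq_integral => x _; apply/esym/cvg_lim.
  - by move=> n; exact/measurable_EFinP.
  - by move=> n x _; rewrite lee_fin.
  - by move=> x _ m n mn; rewrite lee_fin; exact/lefP/nd_nnsfun_approx.
rewrite [RHS](_ : _ = limn (fun n => \int[mu]_x ((h n x)%:E * (w x)%:E))%E);
    last first.
  rewrite -monotone_convergence//.
  - apply: eq_integral => x _; apply/esym/cvg_lim => //.
    by apply: cvgeZr.
  - by move=> n; apply: emeasurable_funM => //; exact/measurable_EFinP.
  - by move=> n x _; rewrite mule_ge0 ?lee_fin.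
  - move=> x _ m n mn; rewrite lee_wpmul2r ?lee_fin//.
    exact/lefP/nd_nnsfun_approx.
congr (limn _); apply/funext => n.
transitivity (\int[nu]_x
   (\sum_(y \in range (h n)) (y * \1_(h n @^-1` [set y]) x)%:E))%E.
  by apply: eq_integral => t tE; rewrite /= fimfunE -fsumEFin.
have indich r : measurable_fun setT
    (fun x => (r * \1_(h n @^-1` [set r]) x)%:E).
  by apply/measurable_EFinP; apply: measurable_funM.
rewrite ge0_integral_fsum//; last by move=> y x _; exact: nnfun_muleindic_ge0.
transitivity (\int[mu]_x (\sum_(y \in range (h n))
    (y * \1_(h n @^-1` [set y]) x)%:E * (w x)%:E))%E; last first.
  apply: eq_integral => x _.
  rewrite -ge0_mule_fsuml => [|y]; last exact: nnfun_muleindic_ge0.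
  by rewrite fsumEFin // -(fimfunE _ x).
rewrite ge0_integral_fsum//; last 2 first.
  - by move=> y; exact: emeasurable_funM.
  - move=> y x _; apply: mule_ge0; last by rewrite lee_fin.
    exact: nnfun_muleindic_ge0.
(* One level [r] at a time: the constant factors out of both integrals, and the indicator restricts
   the integral of [w] to the level set. *)
apply: eq_fsbigr => r rhn.
under eq_integral do rewrite EFinM.
rewrite integralZl_indic_nnsfun => //.
under [RHS]eq_integral do rewrite EFinM -muleA.
rewrite ge0_integralZl//.
- under [in RHS]eq_integral do rewrite muleC.
  rewrite [in RHS](eq_integral ((EFin \o w) \_ (h n @^-1` [set r])));
    last first.
    by move=> x xE; rewrite epatch_indic.
  by rewrite -integral_mkcond integral_indic// setIT nuE.
- by apply: emeasurable_funM => //; exact/measurable_EFinP.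
- by move=> t _; rewrite mule_ge0 ?lee_fin.
- by move: rhn; rewrite inE => -[t _ <-]; rewrite lee_fin.
Qed.

Lemma integral_normal_prob {R : realType} (m : R)
    (f : measurableTypeR R -> \bar R) :
  measurable_fun setT f -> (forall x, (0 <= f x)%E) ->
  (\int[normal_prob m 1]_x f x =
   \int[lebesgue_measure]_x (f x * (normal_pdf m 1 x)%:E))%E.
Proof.
move=> mf f0; apply: integral_density => //.
- exact: measurable_normal_pdf.
- by move=> x; exact: normal_pdf_ge0.
Qed.

(** * Likelihood ratio of N(m,1) against N(0,1) *)

Definition gauss_lr {R : realType} (m x : R) : R := expR (m * x - m ^+ 2 / 2).

Lemma measurable_gauss_lr {R : realType} (m : R) :
  measurable_fun setT (gauss_lr m : measurableTypeR R -> R).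
Proof.
by apply: measurableT_comp => //; exact: measurable_funB.
Qed.

Lemma normal_pdf_lr {R : realType} (m x : R) :
  normal_pdf m 1 x = gauss_lr m x * normal_pdf 0 1 x.
Proof.
rewrite !normal_pdfE ?oner_eq0// /normal_fun mulrCA -expRD.
by congr (_ * expR _); field.
Qed.

Lemma integral_normal_prob_lr {R : realType} (m : R)
    (f : measurableTypeR R -> \bar R) :
  measurable_fun setT f -> (forall x, (0 <= f x)%E) ->
  (\int[normal_prob m 1]_x f x =
   \int[normal_prob 0 1]_x (f x * (gauss_lr m x)%:E))%E.
Proof.
move=> mf f0; rewrite !integral_normal_prob//.
- by apply: eq_integral => x _; rewrite normal_pdf_lr EFinM muleA.
- apply: emeasurable_funM => //; apply/measurable_EFinP.
  exact: measurable_gauss_lr.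
- by move=> x; rewrite mule_ge0// lee_fin expR_ge0.
Qed.

(** Induction on [n] by Tonelli. The one-dimensional hypothesis is stated for all nonnegative
    functions, not just for sets, so that it applies to the partial integral over the remaining
    coordinates. *)
Lemma integral_prod_prob_density {d} {T : measurableType d} {R : realType} {n}
    (P Q : 'I_n -> probability T R) (w : 'I_n -> T -> R) :
  (forall i, measurable_fun setT (w i)) -> (forall i x, 0 <= w i x) ->
  (forall i (f : T -> \bar R), measurable_fun setT f ->
     (forall x, (0 <= f x)%E) ->
     (\int[P i]_x f x = \int[Q i]_x (f x * (w i x)%:E))%E) ->
  forall f : n.-tuple T -> \bar R, measurable_fun setT f ->
    (forall x, (0 <= f x)%E) ->
  (\int[prod_prob P]_x f x =
   \int[prod_prob Q]_x (f x * (\prod_(i < n) w i (tnth x i))%:E))%E.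
Proof.
elim: n P Q w => [|n IHn] P Q w mw w0 PQ f mf f0.
  by apply: eq_integral => x _; rewrite big_ord0 mule1.
have mprod m (u : 'I_m -> T -> R) : (forall i, measurable_fun setT (u i)) ->
    measurable_fun setT (fun x : m.-tuple T => \prod_(i < m) u i (tnth x i)).
  move=> mu; apply: measurable_prod => i _.
  apply: measurableT_comp => //; exact: measurable_tnth.
have mt := @measurable_tcons d T n.
have mfw : measurable_fun setT
    (fun x : n.+1.-tuple T => f x * (\prod_(i < n.+1) w i (tnth x i))%:E)%E.
  by apply: emeasurable_funM => //; apply/measurable_EFinP; exact: mprod.
have fw0 x : (0 <= f x * (\prod_(i < n.+1) w i (tnth x i))%:E)%E.
  by rewrite mule_ge0// lee_fin prodr_ge0.
rewrite /= !ge0_integral_distribution// !fubini_tonelli1/=; last 4 first.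
- exact: (measurableT_comp mfw).
- by move=> x; exact: fw0.
- exact: (measurableT_comp mf).
- by move=> x; exact: f0.
(* The first coordinate changes measure here; the induction hypothesis then treats the inner
   integral, whose weight is pulled back inside. *)
rewrite PQ/=; last 2 first.
- apply: measurable_fun_fubini_tonelli_F => //=.
  exact: (measurableT_comp mf).
- by move=> x; apply: integral_ge0 => y _; exact: f0.
apply: eq_integral => x _; rewrite /fubini_F.
have mtx : measurable_fun setT (fun y : n.-tuple T => tcons (x, y)).
  by apply: measurableT_comp => //; exact: measurable_pair1.
rewrite (IHn _ (fun i => Q (lift ord0 i)) (fun i => w (lift ord0 i)))//=;
  last 2 first.
- by move=> i; exact: PQ.
- exact: (measurableT_comp mf mtx).
rewrite muleC -ge0_integralZl//=; last 3 first.
- apply: emeasurable_funM; first exact: (measurableT_comp mf mtx).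
  apply/measurable_EFinP.
  exact: (mprod _ (fun i => w (lift ord0 i)) (fun i => mw _)).
- by move=> y _; rewrite mule_ge0// lee_fin prodr_ge0.
- by rewrite lee_fin.
apply: eq_integral => y _; rewrite big_ord_recl tnth0 EFinM muleCA.
by congr (_ * (_ * _%:E))%E; apply: eq_bigr => i _; rewrite tnthS.
Qed.

(** * Second-moment bound on a gap of probabilities *)

(** Since [L] has mean 1, [V] is its variance. The condition [a <= b] makes [t] nonnegative, which
    keeps the coefficients below nonnegative. *)
Lemma sqr_prob_gap_le {d} {T : measurableType d} {R : realType}
    (P : probability T R) (L : T -> R) (A : set T) (a b V : R) :
  measurable_fun setT L -> (forall x, 0 <= L x) -> measurable A ->
  (\int[P]_x (L x)%:E = 1)%E -> (\int[P]_x (L x * L x)%:E = (1 + V)%:E)%E ->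
  P A = a%:E -> (\int[P]_x (\1_A x * L x)%:E = b%:E)%E -> a <= b ->
  4 * (b - a) ^+ 2 <= V.
Proof.
move=> mL L0 mA L1 LL PA LA ab.
(* [J] bundles what linearity of the integral needs; [lin] then builds each side of the expanded
   square term by term. *)
pose J (f : T -> R) (u : R) := [/\ measurable_fun [set: T] f,
  forall x, 0 <= f x &
  (\int[P]_x (f x)%:E = u%:E)%E].
have J1 : J (fun=> 1) 1.
  by split=> //; exact: integral_prob1.
have JA : J (\1_A) a.
  split=> [|x|]; [exact: measurable_indic|by []|].
  by rewrite integral_indic// setIT.
have JL : J L 1 by [].
have JLL : J (fun x => L x * L x) (1 + V).
  by split=> // [|x]; [exact: measurable_funM|exact: mulr_ge0].
have JAL : J (fun x => \1_A x * L x) b.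
  split=> // [|x]; last exact: mulr_ge0.
  by apply: measurable_funM => //; exact: measurable_indic.
have lin c f u g v : 0 <= c -> J f u -> J g v ->
    J (fun x => c * f x + g x) (c * u + v).
  move=> c0 [mf f0 fu] [mg g0 gv]; split=> [|x|].
  - by apply: measurable_funD => //; exact: measurable_funM.
  - by rewrite addr_ge0// mulr_ge0.
  under eq_integral do rewrite EFinD.
  rewrite ge0_integralD//; last 4 first.
  - by move=> x _; rewrite lee_fin mulr_ge0.
  - by apply/measurable_EFinP; exact: measurable_funM.
  - by move=> x _; rewrite lee_fin.
  - exact/measurable_EFinP.
  under eq_integral do rewrite EFinM.
  rewrite ge0_integralZl// ?lee_fin// ?fu ?gv//; first exact/measurable_EFinP.
  by move=> x _; rewrite lee_fin.
have /andP[a0 a1] : 0 <= a <= 1.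
  by rewrite -!lee_fin -PA measure_ge0 probability_le1.
set t := 4 * (b - a); have t0 : 0 <= t by rewrite mulr_ge0// subr_ge0.
(* Integrating [(L - 1 - t (\1_A - a)) ^+ 2 >= 0], with the terms arranged so
   that only nonnegative functions are integrated. *)
have c1 : 0 <= 2 * t by rewrite mulr_ge0.
have c2 : 0 <= 2 * t ^+ 2 * a by rewrite mulr_ge0// mulr_ge0// exprn_ge0.
have c3 : 0 <= 2 * t * a by rewrite mulr_ge0.
have c4 : 0 <= 2 * t + t ^+ 2 by rewrite addr_ge0// exprn_ge0.
(* Both chains end in the constant function, which adds the same 1 to each side. *)
have [m1 p1 i1] := lin _ _ _ _ _ (ler0n _ 2) JL
  (lin _ _ _ _ _ c1 JAL (lin _ _ _ _ _ c2 JA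
  (lin _ _ _ _ _ (lexx 0) J1 J1))).
have [m2 p2 i2] := lin _ _ _ _ _ c3 JL (lin _ _ _ _ _ ler01 JLL
  (lin _ _ _ _ _ c4 JA (lin _ _ _ _ _ (sqr_ge0 (1 - t * a)) J1 J1))).
have : 2 * 1 + (2 * t * b + (2 * t ^+ 2 * a * a + (0 * 1 + 1))) <=
    2 * t * a * 1 + (1 * (1 + V) + ((2 * t + t ^+ 2) * a +
      ((1 - t * a) ^+ 2 * 1 + 1))).
  rewrite -lee_fin -i1 -i2; apply: ge0_le_integral => //.
  - by move=> x _; rewrite lee_fin.
  - exact/measurable_EFinP.
  - exact/measurable_EFinP.
  move=> x _; rewrite lee_fin -subr_ge0.
  have -> : \1_A x = (x \in A)%:R :> R by [].
  have sq := sqr_ge0 (L x - 1 - t * ((x \in A)%:R - a)).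
  by case: (x \in A) sq => /= sq; rewrite -(pmulr_rge0 _ (ltr01)); nra.
(* This is the variance of the indicator. Its bound 1/4 explains [t]: the value [4 * (b - a)]
   maximises [2 * t * (b - a) - t ^+ 2 / 4]. *)
have a4 : a * (1 - a) <= 1 / 4 by have := sqr_ge0 (a - 1 / 2); nra.
have := ler_wpM2l (sqr_ge0 (b - a)) a4.
by rewrite /t; nra.
Qed.

(** * Likelihood ratios of Gaussian vectors and their moments *)

Definition gauss_vec_lr {R : realType} {n} (m : 'I_n -> R)
    (x : n.-tuple (measurableTypeR R)) : R :=
  \prod_(i < n) gauss_lr (m i) (tnth x i).

Lemma measurable_gauss_vec_lr {R : realType} {n} (m : 'I_n -> R) :
  measurable_fun setT (gauss_vec_lr m).
Proof.
apply: measurable_prod => i _; apply: measurableT_comp.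
  exact: measurable_gauss_lr.
exact: measurable_tnth.
Qed.

Lemma gauss_vec_lr_ge0 {R : realType} {n} (m : 'I_n -> R) x :
  0 <= gauss_vec_lr m x.
Proof. by apply: prodr_ge0 => i _; exact: expR_ge0. Qed.

(** From [(a + b) ^ 2 = a ^ 2 + 2ab + b ^ 2] in each coordinate. The second factor is again a
    likelihood ratio, of integral 1, so cross moments can be read off. *)
Lemma gauss_vec_lrM {R : realType} {n} (a b : 'I_n -> R) x :
  gauss_vec_lr a x * gauss_vec_lr b x =
  expR (\sum_i a i * b i) * gauss_vec_lr (fun i => a i + b i) x.
Proof.
rewrite expR_sum -!big_split/=; apply: eq_bigr => i _.
by rewrite /gauss_lr -!expRD; congr expR; field.
Qed.

Lemma integral_gauss_prob {R : realType} {n} (m : 'I_n -> R)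
    (f : n.-tuple (measurableTypeR R) -> \bar R) :
  measurable_fun setT f -> (forall x, (0 <= f x)%E) ->
  (\int[gauss_prob m]_x f x =
   \int[P_null R n]_x (f x * (gauss_vec_lr m x)%:E))%E.
Proof.
move=> mf f0.
pose N (m0 : R) : probability (measurableTypeR R) R := normal_prob m0 1.
have := integral_prod_prob_density (fun i => N (m i)) (fun=> N 0)
  (fun i => gauss_lr (m i) : measurableTypeR R -> R).
apply.
- by move=> i; exact: measurable_gauss_lr.
- by move=> i x; exact: expR_ge0.
- by move=> i g mg g0; exact: integral_normal_prob_lr.
- exact: mf.
- exact: f0.
Qed.

Lemma integral_gauss_vec_lr {R : realType} {n} (m : 'I_n -> R) :
  (\int[P_null R n]_x (gauss_vec_lr m x)%:E = 1)%E.
Proof.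
rewrite -(integral_prob1 (gauss_prob m)) integral_gauss_prob.
- by apply: eq_integral => x _; rewrite mul1e.
- exact: measurable_cst.
- by move=> x; exact: lee01.
Qed.

Lemma integral_indic_gauss_vec_lr {R : realType} {n} (m : 'I_n -> R)
    (A : set (n.-tuple (measurableTypeR R))) : measurable A ->
  (\int[P_null R n]_x (\1_A x * gauss_vec_lr m x)%:E = gauss_prob m A)%E.
Proof.
move=> mA; rewrite -(integral_indicT (gauss_prob m) A mA) integral_gauss_prob.
- by apply: eq_integral => x _; exact: EFinM.
- by apply/measurable_EFinP; exact: measurable_indic.
- by move=> x; rewrite lee_fin.
Qed.

Lemma integral_gauss_vec_lrM {R : realType} {n} (a b : 'I_n -> R) :
  (\int[P_null R n]_x (gauss_vec_lr a x * gauss_vec_lr b x)%:E =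
   (expR (\sum_i a i * b i))%:E)%E.
Proof.
under eq_integral do rewrite gauss_vec_lrM EFinM.
rewrite ge0_integralZl.
- by rewrite integral_gauss_vec_lr mule1.
- exact: measurableT.
- by apply/measurable_EFinP; exact: measurable_gauss_vec_lr.
- by move=> x _; rewrite lee_fin gauss_vec_lr_ge0.
- by rewrite lee_fin expR_ge0.
Qed.

(** * Mixtures over the class and the risk of a test *)

Lemma integral_unif_expect {d} {T : measurableType d} {R : realType}
    {I : finType} (P : probability T R) (D : {set I}) (F : I -> T -> R)
    (u : I -> R) :
  (forall i, measurable_fun setT (F i)) -> (forall i x, 0 <= F i x) ->
  (forall i, i \in D -> \int[P]_x (F i x)%:E = (u i)%:E)%E ->
  (\int[P]_x (unif_expect D (F ^~ x))%:E = (unif_expect D u)%:E)%E.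
Proof.
move=> mF F0 Fu; rewrite /unif_expect.
under eq_integral do rewrite mulrC EFinM -sumEFin -big_enum/=.
rewrite ge0_integralZl//; last 2 first.
- by apply: emeasurable_sum => i; exact/measurable_EFinP.
- by move=> x _; apply: sume_ge0 => i _; rewrite lee_fin.
rewrite ge0_integral_sum//; last 2 first.
- by move=> i; exact/measurable_EFinP.
- by move=> i x _; rewrite lee_fin.
by rewrite big_enum/= (eq_bigr _ Fu) sumEFin -EFinM mulrC.
Qed.

Lemma measurable_unif_expect {d} {T : measurableType d} {R : realType}
    {I : finType} (D : {set I}) (F : I -> T -> R) :
  (forall i, measurable_fun setT (F i)) ->
  measurable_fun setT (fun x => unif_expect D (F ^~ x)).
Proof.
move=> mF; apply: measurable_funM => //=.
under eq_fun do rewrite -big_enum/=.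
exact: measurable_sum.
Qed.

Lemma sum_shift_mul {R : realType} {n} (mu : R) (S S' : {set 'I_n}) :
  \sum_i (if i \in S then mu else 0) * (if i \in S' then mu else 0) =
  mu ^+ 2 * #|S :&: S'|%:R.
Proof.
rewrite -sum1_card natr_sum mulr_sumr [RHS]big_mkcond/=.
apply: eq_bigr => i _; rewrite inE.
by case: (i \in S); case: (i \in S'); rewrite /= ?mulr1 ?mulr0 ?mul0r.
Qed.

Lemma measurable_test {R : realType} {n} (f : test R n) :
  measurable [set x | f x]%classic.
Proof.
rewrite (_ : mkset _ = f @^-1` [set true])%classic//.
by rewrite -[(_ @^-1` _)%classic]setTI; exact: measurable_funP.
Qed.

Lemma risk_gap {R : realType} {n} (C : {set {set 'I_n}}) (mu : R)
    (f : test R n) : C != finset.set0 ->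
  1 - risk C mu f =
  unif_expect C (fun S => fine (P_alt mu S [set x | f x]%classic)) -
  fine (P_null R n [set x | f x]%classic).
Proof.
move=> C0; have N0 : (#|C|%:R : R) != 0 by rewrite pnatr_eq0 cards_eq0.
have mf := measurable_test f.
have fineC (p : probability (n.-tuple (measurableTypeR R)) R) :
    fine (p [set x | f x = false]%classic) = 1 - fine (p [set x | f x]%classic).
  rewrite (_ : [set x | f x = false] = ~` [set x | f x])%classic; last first.
    by apply/seteqP; split=> x /=; case: (f x).
  rewrite probability_setC// -[X in (_ - X)%E]fineK//.
  exact: fin_num_measure.
rewrite /risk /unif_expect (eq_bigr _ (fun S _ => fineC (P_alt mu S))).
rewrite sumrB sumr_const mulrBr mulVf// [_^-1 * _]mulrC.
ring.
Qed.

(** The second-moment bound for the mixture likelihood ratio; [risk C mu f <= 1] is exactly its sign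
    condition [a <= b]. *)
Lemma sqr_risk_gap_le {R : realType} {n} (C : {set {set 'I_n}}) (mu : R)
    (f : test R n) : C != finset.set0 -> risk C mu f <= 1 ->
  4 * (1 - risk C mu f) ^+ 2 <=
  unif_expect C (fun S => unif_expect C (fun S' =>
    expR (mu ^+ 2 * #|S :&: S'|%:R))) - 1.
Proof.
move=> C0; rewrite -subr_ge0 risk_gap// subr_ge0 => gap.
have N0 : (#|C|%:R : R) != 0 by rewrite pnatr_eq0 cards_eq0.
pose m (S : {set 'I_n}) i := if i \in S then mu else 0.
have mf := measurable_test f.
have fin (p : probability (n.-tuple (measurableTypeR R)) R) :
    p [set x | f x]%classic = (fine (p [set x | f x]%classic))%:E.
  by rewrite fineK//; exact: fin_num_measure.
have expect1 : unif_expect C (fun=> 1) = 1 :> R.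
  by rewrite /unif_expect sumr_const divff.
have mL (S : {set 'I_n}) : measurable_fun setT (gauss_vec_lr (m S)).
  exact: measurable_gauss_vec_lr.
have mI : measurable_fun setT (\1_([set x | f x]%classic) :
    n.-tuple (measurableTypeR R) -> R) by exact: measurable_indic.
apply: (@sqr_prob_gap_le _ _ _ (P_null R n)
  (fun x => unif_expect C (fun S => gauss_vec_lr (m S) x))
  [set x | f x]%classic) => //.
- exact: measurable_unif_expect.
- by move=> x; apply: unif_expect_ge0 => S; exact: gauss_vec_lr_ge0.
- rewrite -[1 in RHS]expect1; apply: integral_unif_expect => // [S x|S _].
    exact: gauss_vec_lr_ge0.
  exact: integral_gauss_vec_lr.
(* The squared mixture becomes a double average, so that integral and average can be exchanged
   twice. *)
- rewrite subrKC; under eq_integral do rewrite unif_expectM.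
  apply: (integral_unif_expect _ _ (fun S x => unif_expect C (fun S' =>
    gauss_vec_lr (m S) x * gauss_vec_lr (m S') x))) => [S|S x|S SC].
  + by apply: measurable_unif_expect => S'; exact: measurable_funM.
  + by apply: unif_expect_ge0 => S'; rewrite mulr_ge0 ?gauss_vec_lr_ge0.
  apply: integral_unif_expect => [S'|S' x|S' _].
  + exact: measurable_funM.
  + by rewrite mulr_ge0 ?gauss_vec_lr_ge0.
  by rewrite integral_gauss_vec_lrM sum_shift_mul.
- under eq_integral do rewrite /unif_expect mulrA mulr_sumr.
  apply: (integral_unif_expect _ _ (fun S x =>
    \1_([set x | f x]%classic) x * gauss_vec_lr (m S) x)) => [S|S x|S _].
  + exact: measurable_funM.
  + by rewrite mulr_ge0 ?gauss_vec_lr_ge0.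
  + by rewrite integral_indic_gauss_vec_lr// -fin.
Qed.

(** * From the overlap moment to the condition on [mu] *)

Theorem proposition3p4 (R : realType) (delta : R) (n K : nat)
    (C : {set {set 'I_n}})
    (delta_gt0 : 0 < delta) (delta_lt1 : delta < 1)
    (K_ge1 : (1 <= K)%N)
    (cardC : forall S, S \in C -> #|S| = K)
    (* (S, S') is uniform on C x C *)
    (overlap : forall (S1 S2 : {set 'I_n}) (k : nat), S1 \in C -> S2 \in C ->
      unif_cond_prob R (finset.setX C C)
        (fun p => #|p.1 :&: p.2| == k) (fun p => p.2 == S1) =
      unif_cond_prob R (finset.setX C C)
        (fun p => #|p.1 :&: p.2| == k) (fun p => p.2 == S2))
    (marginal : forall (S0 : {set 'I_n}) (i : 'I_n), S0 \in C -> i \in S0 ->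
      unif_prob R C (fun S => i \in S) = K%:R / n%:R)
    (labels : [set i : 'I_n | (i < K)%N] \in C)
    (neg_assoc : negatively_associated C
      (fun (i : {i : 'I_n | (i < K)%N}) (S : {set 'I_n}) =>
         ((val i \in S)%:R : R)))
    (mu : R) (mu_gt0 : 0 < mu)
    (mu_le : mu <= Num.sqrt (ln (1 + n%:R * ln (1 + 4 * (1 - delta) ^+ 2)
                                     / K%:R ^+ 2))) :
  delta <= min_risk C mu.
Proof.
have cardS0 := cardC _ labels; have C0 : C != finset.set0.
  by apply/set0Pn; exists [set i : 'I_n | (i < K)%N]%SET.
have K0 : 0 < K%:R :> R by rewrite ltr0n.
have n0 : 0 < n%:R :> R.
  by rewrite ltr0n (leq_trans K_ge1)// -cardS0 -[leqRHS]card_ord max_card.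
have [f <-] := min_risk_attained C mu.
rewrite leNgt; apply/negP => risk_lt.
have := sqr_risk_gap_le C mu f C0 (ltW (lt_trans risk_lt delta_lt1)).
set v := 1 + 4 * (1 - delta) ^+ 2.
have v1 : 1 <= v by rewrite lerDl mulr_ge0// sqr_ge0.
(* A moment of at most [v] would give [(1 - risk) ^ 2 <= (1 - delta) ^ 2] with both bases
   nonnegative, contradicting [risk_lt]. *)
suff mgf_le : unif_expect C (fun S => unif_expect C (fun S' =>
    expR (mu ^+ 2 * #|S :&: S'|%:R))) <= v.
  move=> gap; have := le_trans gap (lerB mgf_le (lexx 1)).
  rewrite (_ : v - 1 = 4 * (1 - delta) ^+ 2); last by rewrite /v; ring.
  rewrite ler_pM2l// ler_sqr ?nnegrE.
  - by rewrite lerD2l lerN2 leNgt risk_lt.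
  - by rewrite subr_ge0 ltW// (lt_trans risk_lt).
  - by rewrite subr_ge0 ltW.
(* It suffices to bound the inner average for each fixed [S]; hypothesis (i) then replaces [S] by
   the first [K] labels. *)
apply: unif_expect_le => // S SC.
under eq_unif_expect do rewrite finset.setIC.
rewrite (unif_expect_overlap C S _ (fun k => expR (mu ^+ 2 * k%:R)) SC labels);
  last by move=> k; exact: overlap.
apply: (le_trans (negatively_associated_mgf_le (fun i : 'I_n => (i < K)%N) C
  (K%:R / n%:R) (mu ^+ 2) C0 _ _ _ neg_assoc)).
- exact: sqr_ge0.
- by rewrite divr_ge0.
- by move=> i iK; apply: (marginal _ _ labels); rewrite inE.
have -> : #|(fun i : 'I_n => (i < K)%N)| = K.
  by rewrite -[RHS]cardS0; apply: eq_card => i; rewrite !inE.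
have lnv0 : 0 <= ln v by rewrite ln_ge0.
(* Chosen so that [y * K ^ 2 / n = ln v]; the assumption on [mu] amounts to
   [expR (mu ^+ 2) - 1 <= y]. *)
set y := n%:R * ln v / K%:R ^+ 2.
have y0 : 0 <= y by rewrite divr_ge0 ?mulr_ge0// ?ltW ?exprn_gt0.
have mu2 : mu ^+ 2 <= ln (1 + y).
  rewrite -(sqr_sqrtr (ln_ge0 _)) ?lerDl//.
  by rewrite ler_sqr ?nnegrE ?sqrtr_ge0// ltW.
have emu : expR (mu ^+ 2) - 1 <= y.
  by rewrite lerBlDl -[leRHS]lnK ?ler_expR// posrE ltr_wpDr.
rewrite -[leRHS]lnK ?posrE ?(lt_le_trans _ v1)// ler_expR.
apply: (@le_trans _ _ (y * (K%:R / n%:R) * K%:R)).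
  by rewrite ler_wpM2r ?ler_wpM2r ?divr_ge0.
by rewrite le_eqVlt; apply/orP; left; apply/eqP; rewrite /y; field;
  rewrite !gt_eqF.
Qed.
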